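(* Let $\mathbb{F}$ be a field of characteristic different from two and let $(\mathcal{P},\circ,\{\cdot,\cdot\})$ be a simple transposed Poisson algebra over $\mathbb{F}$ such that $\mathcal{P}\circ\mathcal{P}=\mathcal{P}$. Then the associative commutative algebra $(\mathcal{P},\circ)$ is unital.
   Context: A transposed Poisson algebra is a vector space $\mathcal{P}$ (of arbitrary dimension) with an associative commutative multiplication $\circ$ (not assumed unital) and a Lie bracket $\{\cdot,\cdot\}$ such that $2x\circ\{y,z\}=\{x\circ y,z\}+\{y,x\circ z\}$ for all $x,y,z\in\mathcal{P}$. An ideal is a proper nonzero subspace $\mathcal{I}$ with $\mathcal{I}\circ\mathcal{P}\subset\mathcal{I}$ and $\{\mathcal{I},\mathcal{P}\}\subset\mathcal{I}$; $\mathcal{P}\neq 0$ is simple if it contains no ideals. $\mathcal{P}\circ\mathcal{P}$ is the linear span of all products $a\circ b$ with $a,b\in\mathcal{P}$. *)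

(* Defs.v *)
From mathcomp Require Import all_boot all_algebra sesquilinear.

Set Implicit Arguments.
Unset Strict Implicit.
Unset Printing Implicit Defensive.

Import GRing.Theory.
Local Open Scope ring_scope.

Section TransposedPoisson.
Variables (F : fieldType) (P : lmodType F).
Implicit Types (mul br : {bilinear P -> P -> P}) (I A : P -> Prop).

Record is_lie_bracket br : Prop := IsLieBracket {
  lie_alternating : forall x, br x x = 0;
  lie_jacobi : forall x y z,
    br x (br y z) + br y (br z x) + br z (br x y) = 0
}.

Record is_transposed_poisson mul br : Prop := IsTransposedPoisson {
  tpa_mulA : associative mul;
  tpa_mulC : commutative mul;
  tpa_lie : is_lie_bracket br;
  tpa_leibniz : forall x y z,
    mul x (br y z) *+ 2 = br (mul x y) z + br y (mul x z)
}.

(* Subspaces are Prop-valued: [{pred P}] would only cover the decidable ones,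
   and [{vspace _}] needs finite dimension. *)
Record is_subspace A : Prop := IsSubspace {
  subspace0 : A 0;
  subspaceD : forall x y, A x -> A y -> A (x + y);
  subspaceZ : forall (c : F) x, A x -> A (c *: x)
}.

Record is_ideal mul br I : Prop := IsIdeal {
  ideal_subspace : is_subspace I;
  ideal_proper : exists x, ~ I x;
  ideal_nonzero : exists2 x, I x & x != 0;
  ideal_mul : forall x y, I x -> I (mul x y);
  ideal_br : forall x y, I x -> I (br x y)
}.

Definition is_simple mul br : Prop :=
  (exists x : P, x != 0) /\ (forall I, ~ is_ideal mul br I).

Definition linear_span A : P -> Prop := fun x =>
  exists (n : nat) (c : 'I_n -> F) (v : 'I_n -> P),
    (forall i, A (v i)) /\ x = \sum_(i < n) c i *: v i.

Definition mul_square mul : P -> Prop :=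
  linear_span (fun x => exists a b, x = mul a b).

Definition is_unital mul : Prop :=
  exists e, left_id e mul /\ right_id e mul.

End TransposedPoisson.

(* Main.v *)
Require Import Defs.
From mathcomp Require Import all_boot all_algebra sesquilinear.
From mathcomp Require Import zify.
From Stdlib Require Import Classical.

Set Implicit Arguments.
Unset Strict Implicit.
Unset Printing Implicit Defensive.

Import GRing.Theory.
Local Open Scope ring_scope.

(** Put $E_a(x) = \{a, a \circ x\}$.  Since $2$ is invertible, the transposed
    Leibniz rule makes every $E_a$ a derivation of $\circ$.  The squares span
    $\mathcal{P}$, because the products do, and from this it follows that a
    $\circ$-ideal stable under all the $E_a$ is stable under the bracket.  So
    simplicity of $\mathcal{P}$ implies that the commutative associative algebra
    $(\mathcal{P}, \circ)$ is differentially simple for the family $(E_a)$,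
    and the bracket can be forgotten.  Some $b$ has $b^2 \neq 0$, again
    because the squares span.

    It remains to see that a differentially simple commutative algebra $A$
    that contains $b$ with $b^2 \neq 0$ is unital
    ([differentially_simple_unital]).  Its annihilator is a differential ideal
    other than $A$, hence zero.  The combinations of products of two iterated
    derivatives of $b$, with coefficients in $A$, therefore form a nonzero
    differential ideal, so $b$ is such a combination; it involves finitely
    many derivations and terms, hence the total order of differentiation in
    each term is at most some $n$.  Differentiating this relation and
    substituting it into itself writes a derivative of $b$ of order $j$ as a
    combination of products of $m + 2$ derivatives of $b$ of total order at
    most $n (m + 1) + j$ ([ders_wprod_iter]).  The average order of the
    factors then stays about $n$, so for large $m$ at least two of them have
    order at most $n$ ([wprod_low_power]).  Hence the ideal $Q$ generated by
    the derivatives of order at most $n$, which is finitely generated,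
    satisfies $Q = Q^2$, and Nakayama's lemma provides an idempotent $e$ in
    $Q$ with $e b = b$.  A derivation kills every idempotent, so the ideal
    $e A$ is differential; it contains $b$, so it is $A$, and $e$ is the
    unit. *)

(** * Commutative associative algebras without unit *)

Section CommutativeAlgebra.
Variables (F : fieldType) (P : lmodType F) (mul : {bilinear P -> P -> P}).
Hypotheses (mulA : associative mul) (mulC : commutative mul).
Implicit Types (x y z f g : P) (J I : P -> Prop) (ys : seq P).

Local Notation "x ** y" := (mul x y) (at level 40, left associativity).

Lemma mulAC x y z : x ** y ** z = x ** z ** y.
Proof. by rewrite -mulA [y ** z]mulC mulA. Qed.

Lemma subspaceB J x y : is_subspace J -> J x -> J y -> J (x - y).
Proof.
by move=> sJ Jx Jy; rewrite -scaleN1r; apply: subspaceD (subspaceZ sJ _ Jy).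
Qed.

(** The module product $J \cdot ys$.  Listing the coefficients along [ys]
    lets Nakayama's lemma run by induction on the list. *)
Fixpoint combination J ys f : Prop :=
  if ys is y :: ys' then
    exists c g, [/\ J c, combination J ys' g & f = c ** y + g]
  else f = 0.

Lemma combination_subspace J ys :
  is_subspace J -> is_subspace (combination J ys).
Proof.
move=> sJ; elim: ys => [|y ys [IH0 IHD IHZ]] /=; split.
- by [].
- by move=> x y -> ->; rewrite addr0.
- by move=> c x ->; rewrite scaler0.
- by exists 0, 0; rewrite linear0l addr0; split=> //; apply: subspace0.
- move=> _ _ [c [g [Jc Jg ->]]] [d [h [Jd Jh ->]]].
  exists (c + d), (g + h); split; [exact: subspaceD | exact: IHD |].
  by rewrite linearDl addrACA.
- move=> k _ [c [g [Jc Jg ->]]].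
  exists (k *: c), (k *: g); split; [exact: subspaceZ | exact: IHZ |].
  by rewrite linearZl_LR scalerDr.
Qed.

Lemma combination_mul J ys : (forall x y, J x -> J (x ** y)) ->
  forall f z, combination J ys f -> combination J ys (f ** z).
Proof.
move=> mJ; elim: ys => [|y ys IH] f z /= => [->|]; first exact: linear0l.
move=> [c [g [Jc Jg ->]]]; exists (c ** z), (g ** z).
by split; [exact: mJ | exact: IH | rewrite linearDl mulAC].
Qed.

Lemma combination_mem J ys c y :
  is_subspace J -> J c -> y \in ys -> combination J ys (c ** y).
Proof.
move=> sJ Jc; elim: ys => [//|y' ys IH]; rewrite inE => /predU1P[->|y_ys] /=.
  exists c, 0; split; rewrite ?addr0 //.
  exact: subspace0 (combination_subspace ys sJ).
exists 0, (c ** y); split; [exact: subspace0 | exact: IH |].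
by rewrite linear0l add0r.
Qed.

Lemma combination_fixed J ys e f : {in ys, forall y, e ** y = y} ->
  combination J ys f -> e ** f = f.
Proof.
elim: ys f => [|y ys IH] f he /= => [->|]; first exact: linear0r.
move=> [d [h [_ h_ys ->]]]; rewrite linearDr mulA [e ** d]mulC -mulA.
rewrite he ?mem_head // IH // => z z_ys.
by rewrite he // inE z_ys orbT.
Qed.

(** Nakayama's lemma without a unit: $e$ plays the role of $1 - \prod(1-c)$.
    If $y$ is the head of the list and $(1 - c) y$ lies in $J \cdot ys$ for
    its tail $ys$, then multiplying by $1 - c$ eliminates $y$ from the other relations. *)
Lemma nakayama J ys : is_subspace J -> (forall x y, J x -> J (x ** y)) ->
    {in ys, forall y, combination J ys y} ->
  exists2 e, J e & {in ys, forall y, e ** y = y}.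
Proof.
move=> sJ mJ; elim: ys => [_|y ys IH hys].
  by exists 0; [exact: subspace0 | move=> y].
have [c [g [Jc g_ys y_eq]]] := hys _ (mem_head y ys).
have [] := IH.
  move=> z z_ys; have [|k [h [Jk h_ys z_eq]]] := hys z.
    by rewrite inE z_ys orbT.
  have sub_ys := combination_subspace ys sJ.
  (* z = c z + (1 - c) z, where (1 - c) z = k ((1 - c) y) + (1 - c) h *)
  have ->: z = c ** z + (k ** g + (h - c ** h)).
    have ->: c ** z = k ** (c ** y) + c ** h.
      by rewrite z_eq linearDr !mulA [c ** k]mulC.
    by rewrite addrACA -linearDr -y_eq [c ** h + _]addrC subrK.
  apply: subspaceD => //; first exact: combination_mem.
  apply: subspaceD => //; first by rewrite mulC; apply: combination_mul.
  by apply: subspaceB => //; rewrite mulC; apply: combination_mul.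
move=> e Je he; exists (e + c - e ** c).
  by apply: subspaceB; [|exact: subspaceD|exact: mJ].
move=> z; rewrite inE => /predU1P[->|z_ys].
  (* (1 - e) kills g = (1 - c) y *)
  have gE: y - c ** y = g by rewrite {1}y_eq addrAC subrr add0r.
  have := combination_fixed he g_ys; rewrite -gE linearBr => eg.
  rewrite linearBl linearDl -mulA addrAC eg.
  by rewrite subrK.
by rewrite linearBl linearDl he // mulAC he // [z ** c]mulC addrK.
Qed.

Fixpoint ideal_power ys q : P -> Prop :=
  if q is q'.+1 then combination (ideal_power ys q') ys else fun=> True.

Lemma ideal_power_subspace ys q : is_subspace (ideal_power ys q).
Proof. by elim: q => [|q IH] //=; apply: combination_subspace. Qed.

Lemma ideal_power_mul ys q f z :
  ideal_power ys q f -> ideal_power ys q (f ** z).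
Proof. by elim: q f z => [|q IH] f z //; apply: combination_mul. Qed.

(** A finitely generated ideal $Q$ with $Q = Q^2$ has a unit: the element
    given by Nakayama's lemma fixes $Q$ and belongs to it. *)
Lemma idempotent_of_ideal_square ys :
    {in ys, forall y, ideal_power ys 2 y} ->
  exists2 e, e ** e = e & {in ys, forall y, e ** y = y}.
Proof.
move=> Q2; have [e Qe he] := nakayama (ideal_power_subspace ys 1)
  (@ideal_power_mul ys 1) Q2.
by exists e => //; apply: combination_fixed Qe.
Qed.

(** * Differentially simple algebras *)

Section Derivations.
Variables (T : eqType) (der : T -> {linear P -> P}).
Hypothesis derM : forall a x y, der a (x ** y) = der a x ** y + x ** der a y.
Implicit Types (S : seq T).

Definition differentially_closed I : Prop :=
  [/\ is_subspace I, forall x y, I x -> I (x ** y)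
    & forall a x, I x -> I (der a x)].

Lemma der_idempotent a e : e ** e = e -> der a e = 0.
Proof.
move=> ee.
have dE: der a e = e ** der a e + e ** der a e.
  by rewrite -{1}ee derM [_ ** e]mulC.
have := congr1 (mul e) dE; rewrite linearDr mulA ee => /eqP.
rewrite -subr_eq0 opprD addrA subrr sub0r oppr_eq0 => /eqP ed0.
by rewrite dE ed0 addr0.
Qed.

Section DerivativesOf.
Variable b : P.

(** Only derivations from a finite list [S] are iterated, so that there are
    finitely many derivatives of each order. *)
Fixpoint ders S k : seq P :=
  if k is k'.+1 then [seq der a y | a <- S, y <- ders S k'] else [:: b].

Lemma sub_ders S S' k : {subset S <= S'} -> {subset ders S k <= ders S' k}.
Proof.
move=> sSS'; elim: k => [//|k IH] _ /allpairsP[[a y] [/= aS yk ->]].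
by apply: allpairs_f; [exact: sSS' | exact: IH].
Qed.

Definition low_ders S n : seq P := flatten [seq ders S j | j <- iota 0 n.+1].

Lemma mem_low_ders S n j y : (j <= n)%N -> y \in ders S j -> y \in low_ders S n.
Proof.
by move=> le_jn yj; apply/flatten_mapP; exists j; rewrite // mem_iota.
Qed.

(** A weighted filtration: [m] counts the factors that are derivatives of
    [b], and [k] bounds the sum of their orders.  The free [k] of
    [wprod_coef] puts the slack of this bound into the coefficient. *)
Inductive wprod S : nat -> nat -> P -> Prop :=
| wprod_coef k c : wprod S 0 k c
| wprod0 m k : wprod S m k 0
| wprodD m k f g : wprod S m k f -> wprod S m k g -> wprod S m k (f + g)
| wprod_der m k j h y :
    wprod S m k h -> y \in ders S j -> wprod S m.+1 (k + j) (h ** y).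

Lemma wprodZ S m k c f : wprod S m k f -> wprod S m k (c *: f).
Proof.
elim=> {m k f} [k d|m k|m k f g _ IHf _ IHg|m k j h y _ IH yj].
- exact: wprod_coef.
- by rewrite scaler0; apply: wprod0.
- by rewrite scalerDr; apply: wprodD.
- by rewrite -linearZl_LR; apply: wprod_der.
Qed.

Lemma wprodM S m k f z : wprod S m k f -> wprod S m k (f ** z).
Proof.
elim=> {m k f} [k d|m k|m k f g _ IHf _ IHg|m k j h y _ IH yj].
- exact: wprod_coef.
- by rewrite linear0l; apply: wprod0.
- by rewrite linearDl; apply: wprodD.
- by rewrite mulAC; apply: wprod_der.
Qed.

Lemma wprod_mono S S' m k k' f : {subset S <= S'} -> (k <= k')%N ->
  wprod S m k f -> wprod S' m k' f.
Proof.
move=> sSS' le_kk' wf.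
elim: wf k' le_kk' => {m k f}
  [k d|m k|m k f g _ IHf _ IHg|m k j h y _ IH yj] k' le.
- exact: wprod_coef.
- exact: wprod0.
- by apply: wprodD; [exact: IHf | exact: IHg].
- have ->: k' = (k' - j + j)%N by lia.
  by apply: wprod_der (sub_ders sSS' yj); apply: IH; lia.
Qed.

Lemma wprod_mul S m k m' k' f g :
  wprod S m k f -> wprod S m' k' g -> wprod S (m + m') (k + k') (f ** g).
Proof.
move=> wf; elim=> {m' k' g}
  [k' d|m' k'|m' k' g g' _ IHf _ IHg|m' k' j h y _ IH yj].
- rewrite addn0; apply: wprodM; apply: wprod_mono wf => //; lia.
- by rewrite linear0r; apply: wprod0.
- by rewrite linearDr; apply: wprodD.
- by rewrite mulA addnS addnA; apply: wprod_der.
Qed.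

Lemma wprod_derivative S a m k f :
  a \in S -> wprod S m k f -> wprod S m k.+1 (der a f).
Proof.
move=> aS; elim=> {m k f} [k d|m k|m k f g _ IHf _ IHg|m k j h y wh IH yj].
- exact: wprod_coef.
- by rewrite linear0; apply: wprod0.
- by rewrite linearD; apply: wprodD.
- rewrite derM; apply: wprodD; first by rewrite -addSn; apply: wprod_der.
  by rewrite -addnS; apply: wprod_der => //; apply: allpairs_f.
Qed.

Section QuadraticRelation.
Variables (S : seq T) (n : nat).
Hypothesis b_quadratic : wprod S 2 n b.

Lemma ders_quadratic j y : y \in ders S j -> wprod S 2 (n + j) y.
Proof.
elim: j y => [|j IH] y; first by rewrite inE addn0 => /eqP->.
move=> /allpairsP[[a x] [/= aS xj ->]].
by rewrite addnS; apply: wprod_derivative; auto.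
Qed.

(** Substituting the quadratic relation for one factor adds one factor, and
    $n$ to the total order. *)
Lemma wprod_raise m k f : wprod S m k f -> (0 < m)%N -> wprod S m.+1 (k + n) f.
Proof.
elim=> {m k f} [//|m k|m k f g _ IHf _ IHg|m k j h y wh _ yj] m_gt0.
- exact: wprod0.
- by apply: wprodD; auto.
- rewrite -addn2 -addnA [(j + n)%N]addnC.
  exact: wprod_mul (ders_quadratic yj).
Qed.

Lemma ders_wprod_iter m j y :
  y \in ders S j -> wprod S m.+2 (n * m.+1 + j) y.
Proof.
move=> yj; elim: m => [|m IH]; first by rewrite muln1; apply: ders_quadratic.
by rewrite mulnSr addnAC; apply: wprod_raise.
Qed.

(** Among [m] derivatives of total order at most [k], at most $k / (n+1)$
    have order greater than [n]; the hypothesis says that at least [q]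
    others remain. *)
Lemma wprod_low_power m k q f : wprod S m k f ->
  (k + n.+1 * q < n.+1 * m.+1)%N -> ideal_power (low_ders S n) q f.
Proof.
move=> wf; elim: wf q => {m k f}
  [k d|m k|m k f g _ IHf _ IHg|m k j h y _ IH yj] q lt.
- have ->: q = 0%N by nia.
  by [].
- exact: subspace0 (ideal_power_subspace _ _).
- by apply: (subspaceD (ideal_power_subspace _ _)); auto.
- have [le_jn|lt_nj] := leqP j n; last by apply: ideal_power_mul; apply: IH; nia.
  case: q lt => [//|q] lt.
  apply: (combination_mem (J := ideal_power _ q)); [| |exact: mem_low_ders yj].
    exact: ideal_power_subspace.
  by apply: IH; nia.
Qed.

Lemma exists_idempotent : exists2 e, e ** e = e & e ** b = b.
Proof.
have [y|e ee he] := @idempotent_of_ideal_square (low_ders S n).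
  move=> /flatten_mapP[j _ yj].
  by apply: wprod_low_power (ders_wprod_iter j yj) _; nia.
by exists e => //; apply/he/(@mem_low_ders _ _ 0); rewrite ?mem_head.
Qed.

End QuadraticRelation.

(** For a fixed [S] these elements would only be stable under the derivations
    of [S]; the union over all [S] is a differential ideal. *)
Definition quadratic f : Prop := exists S n, wprod S 2 n f.

Lemma quadratic_closed : differentially_closed quadratic.
Proof.
split; first split.
- by exists [::], 0%N; apply: wprod0.
- move=> x y [S [n wx]] [S' [n' wy]]; exists (S ++ S'), (n + n')%N.
  apply: wprodD; [apply: wprod_mono wx | apply: wprod_mono wy]; try lia.
    by move=> a aS; rewrite mem_cat aS.
  by move=> a aS; rewrite mem_cat aS orbT.
- by move=> c x [S [n wx]]; exists S, n; apply: wprodZ.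
- by move=> x y [S [n wx]]; exists S, n; apply: wprodM.
move=> a x [S [n wx]]; exists (a :: S), n.+1.
apply: wprod_derivative; first exact: mem_head.
by apply: wprod_mono wx => // c cS; rewrite inE cS orbT.
Qed.

Lemma quadratic_square x : quadratic (x ** b ** b).
Proof.
exists [::], (0 + 0 + 0)%N.
by do 2!(apply: wprod_der; last exact: mem_head); apply: wprod_coef.
Qed.

End DerivativesOf.

Lemma annihilator_closed :
  differentially_closed (fun x => forall y, x ** y = 0).
Proof.
split; first split.
- by move=> y; apply: linear0l.
- by move=> x x' x0 x'0 y; rewrite linearDl x0 x'0 addr0.
- by move=> c x x0 y; rewrite linearZl_LR x0 scaler0.
- by move=> x z x0 y; rewrite x0 linear0l.
by move=> a x x0 y; have := derM a x y; rewrite !x0 linear0 addr0.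
Qed.

Theorem differentially_simple_unital :
    (forall I, differentially_closed I -> (exists2 x, I x & x != 0) ->
       forall x, I x) ->
    (exists b, b ** b != 0) ->
  is_unital mul.
Proof.
move=> dsimple [b bb_neq0].
have quad_b: quadratic b b.
  apply: (dsimple _ (quadratic_closed b)).
  have [[x xbb]|all0] := classic (exists x, x ** b ** b != 0).
    by exists (x ** b ** b) => //; apply: quadratic_square.
  have [] := elimN eqP bb_neq0; apply: (dsimple _ annihilator_closed).
  exists (b ** b) => // y; apply/eqP/negP => /negP bby; apply: all0.
  by exists y; rewrite -mulA mulC.
have [S [n b_quadratic]] := quad_b.
have [e ee eb] := exists_idempotent b_quadratic.
have eid: left_id e mul.
  apply: (dsimple (fun x => e ** x = x)); last first.
    exists b => //; apply: contraNneq bb_neq0 => ->.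
    by rewrite linear0l.
  split; first split.
  - exact: linear0r.
  - by move=> x y ex ey; rewrite linearDr ex ey.
  - by move=> c x ex; rewrite linearZr_LR ex.
  - by move=> x y ex; rewrite mulA ex.
  by move=> a x ex; rewrite -{2}ex derM (der_idempotent _ ee) linear0l add0r.
by exists e; split=> // x; rewrite mulC eid.
Qed.

End Derivations.
End CommutativeAlgebra.

(** * Transposed Poisson algebras *)

Section TransposedPoissonAlgebra.
Variables (F : fieldType) (P : lmodType F) (mul br : {bilinear P -> P -> P}).
Hypotheses (char_neq2 : 2%N \notin [pchar F]).
Hypothesis tpa : is_transposed_poisson mul br.
Implicit Types (x y z a b : P) (I : P -> Prop).

Local Notation "x ** y" := (mul x y) (at level 40, left associativity).
Local Notation "⦃ x , y ⦄" := (br x y).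

Let mulA := tpa_mulA tpa.
Let mulC := tpa_mulC tpa.

Lemma two_neq0 : (2%:R : F) != 0.
Proof. by move: char_neq2; rewrite inE. Qed.

Lemma double_inj x y : x *+ 2 = y *+ 2 -> x = y.
Proof. by rewrite -!scaler_nat => /(scalerI two_neq0). Qed.

Lemma br_antisym x y : ⦃x, y⦄ = - ⦃y, x⦄.
Proof.
have := lie_alternating (tpa_lie tpa) (x + y).
rewrite linearDl !linearDr !(lie_alternating (tpa_lie tpa)) add0r addr0.
by move/eqP; rewrite addr_eq0 => /eqP.
Qed.

Definition square_der a : {linear P -> P} := br a \o mul a.

(** In the sum of the Leibniz rules for $2y \circ \{a, ax\}$ and
    $2x \circ \{a, ay\}$ the terms $\{ya, ax\}$ and $\{xa, ay\}$ cancel. *)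
Lemma square_derM a x y :
  square_der a (x ** y) = square_der a x ** y + x ** square_der a y.
Proof.
have leibniz_a u v :
    u ** ⦃a, a ** v⦄ *+ 2 = ⦃a ** u, a ** v⦄ + ⦃a, a ** (u ** v)⦄.
  by rewrite (tpa_leibniz tpa) [u ** a]mulC !mulA [u ** a]mulC.
apply: double_inj; rewrite /= mulrnDl [⦃_, a ** x⦄ ** y]mulC !leibniz_a.
by rewrite [⦃a ** x, _⦄]br_antisym [y ** x]mulC addrACA subrr add0r mulr2n.
Qed.

(** Summing the Leibniz rule cyclically, the right-hand sides cancel in pairs
    by antisymmetry. *)
Lemma br_cyclic x y z : x ** ⦃y, z⦄ + y ** ⦃z, x⦄ + z ** ⦃x, y⦄ = 0.
Proof.
apply: double_inj; rewrite mul0rn !mulrnDl !(tpa_leibniz tpa).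
rewrite [y ** x]mulC [z ** x]mulC [z ** y]mulC.
rewrite [⦃z, x ** y⦄]br_antisym [⦃x, y ** z⦄]br_antisym [⦃y, x ** z⦄]br_antisym.
rewrite [⦃x ** y, z⦄ - _]addrC -[_ + ⦃x ** y, z⦄ + _]addrA [⦃x ** y, z⦄ + _]addrC.
by rewrite subrK [X in X + _]addrC addrA subrK subrr.
Qed.

(** Recovers the bracket, up to squares, from the derivations: three cyclic
    identities and one Leibniz rule. *)
Lemma square_mul_br a x y :
  (a ** a) ** ⦃x, y⦄ = x ** square_der a y - y ** square_der a x.
Proof.
have x_der : x ** ⦃a, a ** y⦄ = a ** ⦃x, a ** y⦄ + (a ** y) ** ⦃a, x⦄.
  apply/eqP; rewrite -subr_eq0 -oppr_eq0 opprB addrAC -linearNr -br_antisym.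
  by rewrite br_cyclic.
have y_der : - (y ** ⦃a, a ** x⦄) = a ** ⦃a ** x, y⦄ + (a ** x) ** ⦃y, a⦄.
  by apply/eqP; rewrite eq_sym -addr_eq0 addrC addrA br_cyclic.
have cyc : y ** ⦃a, x⦄ + x ** ⦃y, a⦄ = - (a ** ⦃x, y⦄).
  by apply/eqP; rewrite -addr_eq0 addrAC br_cyclic.
rewrite /= x_der y_der addrACA -!mulA -!linearDr cyc.
rewrite [⦃x, _⦄ + _]addrC -(tpa_leibniz tpa) mulr2n.
by rewrite addrK.
Qed.

Hypothesis mul_full : forall x, mul_square mul x.

(** Products are combinations of squares by polarization, so the squares span
    because the products do. *)
Lemma square_span I : is_subspace I -> (forall x, I (x ** x)) -> forall x, I x.
Proof.
move=> sI sqI x; have [n [c [v [v_mul ->]]]] := mul_full x.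
have I_half y : I (y *+ 2) -> I y.
  move=> /(subspaceZ sI 2%:R^-1).
  by rewrite -scaler_nat scalerA mulVf ?two_neq0 // scale1r.
elim/big_ind: _ => [||i _]; [exact: subspace0 | exact: subspaceD |].
apply: subspaceZ => //; have [a [b ->]] := v_mul i; apply: I_half.
have ->: a ** b *+ 2 = (a + b) ** (a + b) - a ** a - b ** b.
  rewrite linearDl !linearDr [b ** a]mulC [a ** a + _]addrC addrACA.
  by rewrite -[_ - _ - _]addrA -opprD addrK mulr2n.
by do 2!apply: subspaceB => //.
Qed.

(** First $a \{x, y\} \in I$ for all $a$, by [square_mul_br]; then
    $\{x, a^2\} = 2a\{x, a\} + E_a(x)$ is in $I$. *)
Lemma differentially_closed_br I : differentially_closed mul square_der I ->
  forall x y, I x -> I ⦃x, y⦄.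
Proof.
move=> [sI mI dI] x y Ix.
have Ibr a z : I (a ** ⦃x, z⦄).
  apply: (square_span (I := fun a => I (a ** ⦃x, z⦄))) => [|{}a].
    split=> [|b c Ib Ic|k b Ib].
    - by rewrite linear0l; apply: subspace0.
    - by rewrite linearDl; apply: subspaceD.
    - by rewrite linearZl_LR; apply: subspaceZ.
  rewrite square_mul_br; apply: subspaceB => //; first exact: mI.
  by rewrite mulC; apply/mI/dI.
apply: (square_span (I := fun y => I ⦃x, y⦄)) => [|a].
  split=> [|b c Ib Ic|k b Ib].
  - by rewrite linear0r; apply: subspace0.
  - by rewrite linearDr; apply: subspaceD.
  - by rewrite linearZr_LR; apply: subspaceZ.
have ->: ⦃x, a ** a⦄ = a ** ⦃x, a⦄ *+ 2 + square_der a x.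
  by rewrite (tpa_leibniz tpa) /= [⦃a, _⦄]br_antisym addrAC subrr add0r.
apply: subspaceD => //; last exact: dI.
by rewrite mulr2n; apply: subspaceD.
Qed.

End TransposedPoissonAlgebra.

Theorem theorem30 (F : fieldType) (P : lmodType F)
    (mul br : {bilinear P -> P -> P})
    (char_neq2 : 2%N \notin [pchar F])
    (tpa : is_transposed_poisson mul br)
    (simple : is_simple mul br)
    (mul_full : forall x : P, mul_square mul x) :
  is_unital mul.
Proof.
have [[x x_neq0] no_ideal] := simple.
apply: (differentially_simple_unital (tpa_mulA tpa) (tpa_mulC tpa)
          (square_derM char_neq2 tpa)).
  move=> I dI I_neq0 y; apply: NNPP => nIy; apply: (no_ideal I).
  have [sI mI _] := dI; split=> //; first by exists y.
  exact: differentially_closed_br dI.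
apply: NNPP => no_square; have /eqP[] := x_neq0.
apply: (square_span char_neq2 tpa mul_full (I := fun x => x = 0)) => [|b].
  by split=> [//|_ _ -> ->|c _ ->]; rewrite ?addr0 ?scaler0.
by apply/eqP/negP => /negP bb; apply: no_square; exists b.
Qed.
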